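(* Consider the gadget instance with $n$ gadgets described in the context, run by any ack-only distributed algorithm in which all senders start at the same time in the same state and execute the identical randomized algorithm. Let $I(n)$ be the smallest time at which none of the gadgets is active. Then ${\mathbb{E}}(I(n))=\Omega(\log n)$.
   Context: SINR model: a link $\ell_v$ has sender $s_v$ and receiver $r_v$; with uniform power, a transmitting link $\ell_v$ succeeds iff $\frac{1/\ell_v^\alpha}{\sum_{\ell_w\in S\setminus\{\ell_v\}}1/d(s_w,r_v)^\alpha+N}\ge\beta$, where $S$ is the set of links transmitting in that slot. Instance: $\alpha>1$, $\beta=2$, $N=0$, uniform power; for $i=1,\dots,n$, gadget $g_i$ consists of two identical links of length $1$ on the real line, both senders at point $2ni$ and both receivers at point $2ni+1$ (this set of $2n$ links can be scheduled in 2 slots). Gadget $g_i$ is active at time $t$ if neither of its links has succeeded by time $t-1$. An ack-only algorithm is one where the only external information a sender receives is an acknowledgement of its own successful transmission. *)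

(* Defs.v *)
From HB Require Import structures.
From mathcomp Require Export all_boot all_order all_algebra.
From mathcomp Require Export all_classical all_reals all_analysis.

Set Implicit Arguments.
Unset Strict Implicit.
Unset Printing Implicit Defensive.

Import Order.TTheory GRing.Theory Num.Theory.

Local Open Scope classical_set_scope.
Local Open Scope ring_scope.

Record link (R : realType) := Link { sender : R; receiver : R }.

Section SINR.
Variables (R : realType) (alpha beta N : R) (V : finType) (L : V -> link R).

Definition dist (w v : V) : R := `|sender (L w) - receiver (L v)|.

(* All quotients are taken in the extended reals, where 1 / 0 = +oo: with N = 0
   a link that transmits alone has SINR +oo, and hence succeeds. *)
Definition received_power (w v : V) : \bar R := ((dist w v `^ alpha)%:E^-1)%E.

Definition sinr (S : {set V}) (v : V) : \bar R :=
  (received_power v v /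
    (\sum_(w in S | w != v) received_power w v + N%:E))%E.

Definition success (S : {set V}) (v : V) : bool :=
  (v \in S) && (beta%:E <= sinr S v)%E.

End SINR.

(* A sender holds an internal state and a private random tape of type X.  In
   each slot it decides from these whether to transmit, then moves to a new
   state; the boolean argument of [next], which says whether its own
   transmission of this slot succeeded, is the only external information it
   ever receives. *)
Record ack_only_algorithm (d : measure_display) (X : measurableType d) := AckOnly {
  state_display : measure_display;
  state : measurableType state_display;
  init : state;
  transmit : state * X -> bool;
  next : bool -> state * X -> state;
  measurable_transmit : measurable_fun setT transmit;
  measurable_next : forall ack : bool, measurable_fun setT (next ack) }.

Section Execution.
Variables (R : realType) (alpha beta N : R) (V : finType) (L : V -> link R).
Variables (d : measure_display) (X : measurableType d).
Variables (A : ack_only_algorithm X) (tape : V -> X).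

Definition transmitters (st : V -> state A) : {set V} :=
  finset (fun v => transmit (st v, tape v)).

(* The states at the end of slot t; the slots are 1, 2, 3, and so on. *)
Fixpoint config (t : nat) : V -> state A :=
  if t is t'.+1 then
    fun v => next (success alpha beta N L (transmitters (config t')) v)
                  (config t' v, tape v)
  else fun=> init A.

Definition succeeds_at (t : nat) (v : V) : bool :=
  success alpha beta N L (transmitters (config t.-1)) v.

End Execution.

Section Gadgets.
Variables (R : realType) (alpha : R) (n : nat).

(* The index i : 'I_n stands for gadget i + 1; the boolean selects one of the
   two links of the gadget. *)
Definition gadget_links (v : 'I_n * bool) : link R :=
  Link ((2 * n * v.1.+1)%:R) ((2 * n * v.1.+1)%:R + 1).

Variables (d : measure_display) (X : measurableType d).
Variables (A : ack_only_algorithm X) (tape : 'I_n * bool -> X).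

Definition active (i : 'I_n) (t : nat) : Prop :=
  forall (s : nat) (b : bool), (1 <= s <= t.-1)%N ->
    ~~ succeeds_at alpha 2 0 gadget_links A tape s (i, b).

(* I(n), with value +oo (the infimum of the empty set) if some gadget stays
   active forever. *)
Definition inactivity_time : \bar R :=
  ereal_inf [set (t%:R)%:E | t in
    [set t : nat | (1 <= t)%N /\ forall i : 'I_n, ~ active i t]].

End Gadgets.

Section IID.
Variables (R : realType) (d d' : measure_display).
Variables (T : measurableType d) (X : measurableType d').
Variables (P : probability T R) (V : finType) (xi : V -> {RV P >-> X}).

Definition mutually_independent : Prop :=
  forall (J : {set V}) (B : V -> set X), (forall v, measurable (B v)) ->
    P (\bigcap_(v in [set` J]) (xi v @^-1` B v))
    = (\prod_(v in J) P (xi v @^-1` B v))%E.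

Definition identically_distributed : Prop :=
  forall (v w : V) (B : set X), measurable B ->
    P (xi v @^-1` B) = P (xi w @^-1` B).

End IID.

(* Main.v *)
(** Until its first acknowledgement a sender behaves as a function of its own
    tape alone.  So as long as the two senders of a gadget make the same
    transmit/idle decisions, every slot is either silent or a collision in that
    gadget, whatever the other gadgets do, and the gadget stays active.  The
    decisions in slots 1, ..., k form one of 2^k words, so two independent
    identically distributed words coincide with probability at least 2^-k by
    the Cauchy-Schwarz inequality.  The gadgets being independent, all of them
    see two different words with probability at most (1 - 2^-k)^n, which is at
    most exp(-1) < 1/2 when 2^k <= n.  With k the integer part of log2 n, this
    gives E(I(n)) >= (k + 1) / 2 >= ln n / 2. *)

From mathcomp Require Import ring lra.
Require Import Defs.

Set Implicit Arguments.
Unset Strict Implicit.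
Unset Printing Implicit Defensive.

Import Order.TTheory GRing.Theory Num.Theory.
Local Open Scope classical_set_scope.
Local Open Scope ring_scope.

(** * Collision probability on a finite set, and tools from measure theory *)

Section Counting.
Variables (R : realFieldType) (W : finType) (p : W -> R).
Hypothesis p1 : \sum_u p u = 1.

Lemma card_gt0_of_sum1 : (0 < #|W|)%N.
Proof.
rewrite lt0n; apply/eqP => W0; move/eqP: p1.
rewrite big1 ?(eq_sym 0) ?oner_eq0//.
by move=> u _; have := card0_eq W0 u; rewrite inE.
Qed.

(** The squared deviations of [p] from the uniform weight have a nonnegative sum; expanded with
    [p1], it is the difference of the two sides. *)
Lemma sum_sqr_ge : #|W|%:R^-1 <= \sum_u p u ^+ 2.
Proof.
set m : R := #|W|%:R.
have m0 : m != 0 by rewrite pnatr_eq0 -lt0n card_gt0_of_sum1.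
have : 0 <= \sum_u (p u - m^-1) ^+ 2 by apply: sumr_ge0 => u _; exact: sqr_ge0.
rewrite (eq_bigr (fun u => p u ^+ 2 + (- (2 * m^-1) * p u + m^-1 ^+ 2)))//;
  last by move=> u _; ring.
rewrite big_split big_split /= -mulr_sumr p1 sumr_const.
rewrite -[X in _ + (_ + X)]mulr_natl -/m.
have -> : - (2 / m) * 1 + m * m^-1 ^+ 2 = - m^-1 by field.
by rewrite subr_ge0.
Qed.

Lemma sum_neq_le :
  \sum_(q : W * W | q.1 != q.2) p q.1 * p q.2 <= 1 - #|W|%:R^-1.
Proof.
have : \sum_(q : W * W) p q.1 * p q.2 = 1.
  rewrite -(pair_bigA _ (fun a b => p a * p b)) /=.
  by under eq_bigr do rewrite -mulr_sumr p1 mulr1.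
rewrite (bigID (fun q : W * W => q.1 == q.2)) /= => H.
rewrite -[X in X - _]H -subr_ge0 [X in 0 <= X - _]addrAC addrK subr_ge0.
suff -> : \sum_(q : W * W | q.1 == q.2) p q.1 * p q.2 = \sum_u p u ^+ 2.
  exact: sum_sqr_ge.
rewrite -(pair_big_dep predT (fun a b => a == b) (fun a b => p a * p b)) /=.
by apply: eq_bigr => u _; rewrite (big_pred1 u)// => v; rewrite eq_sym.
Qed.

End Counting.

(* The scaled indicator of [D] is a simple function below [f], and the integral
   of a nonnegative function is the supremum over such functions. *)
Lemma ge0_integral_ge_mass (d : measure_display) (T : measurableType d)
    (R : realType) (mu : {measure set T -> \bar R}) (f : T -> \bar R)
    (D : set T) (r : R) :
  measurable D -> 0 <= r -> (forall x, 0 <= f x)%E ->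
  (forall x, D x -> r%:E <= f x)%E -> (r%:E * mu D <= \int[mu]_x f x)%E.
Proof.
move=> mD r0 f0 rf; rewrite ge0_integralTE//.
apply: ereal_sup_ubound; exists (scale_nnsfun (indic_nnsfun R mD) r0).
  move=> x; rewrite -[X in X%:E]/(r * \1_D x) indicE; have [xD|xD] := boolP (x \in D).
    by rewrite mulr1; apply: rf; rewrite inE in xD.
  by rewrite mulr0.
by rewrite sintegralrM sintegral_indic.
Qed.

(** [W] carries no sigma-algebra, so measurability is asked of the fibres of [f], which partition
    the preimage into finitely many pieces. *)
Lemma measure_preimage_finType (d : measure_display) (T : measurableType d)
    (R : realType) (mu : {measure set T -> \bar R}) (W : finType) (f : T -> W)
    (Q : pred W) : (forall u, measurable (f @^-1` [set u])) ->
  mu (f @^-1` [set` Q]) = (\sum_(u | Q u) mu (f @^-1` [set u]))%E.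
Proof.
move=> mf.
have -> : f @^-1` [set` Q] = \bigcup_(u in [set` Q]) f @^-1` [set u].
  by apply/seteqP; split=> [x Qx|x [u Qu /= ->]]//; exists (f x).
rewrite measure_fin_bigcup//; last exact: trivIset_preimage1.
by rewrite -(bigfs _ (index_enum_uniq W))// => u _; rewrite mem_index_enum.
Qed.

(** * Independent tapes read through a finite code *)

Section PairsOfCodes.
Variables (R : realType) (d d' : measure_display) (T : measurableType d).
Variables (X : measurableType d') (P : probability T R) (n : nat).
Variable xi : 'I_n * bool -> {RV P >-> X}.
Variables (W : finType) (code : X -> W).
Hypothesis mcode : forall u, measurable (code @^-1` [set u]).

Let codes (w : T) : {ffun 'I_n -> W * W} :=
  [ffun i => (code (xi (i, true) w), code (xi (i, false) w))].

(** Splits the event [codes w = g] into one condition per tape, the form to which mutual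
    independence applies. *)
Let B (g : {ffun 'I_n -> W * W}) (v : 'I_n * bool) : set X :=
  code @^-1` [set if v.2 then (g v.1).1 else (g v.1).2].

Let codesE g : codes @^-1` [set g] =
  \bigcap_(v in [set` [set: 'I_n * bool]%SET]) (xi v @^-1` B g v).
Proof.
apply/seteqP; split=> [w /= <- [i b] _ |w /= H].
  by rewrite /B /= ffunE; case: b.
apply/ffunP => i; rewrite ffunE [RHS]surjective_pairing.
by congr pair; [have := H (i, true)|have := H (i, false)]; apply; rewrite /= inE.
Qed.

Let mxi v (Y : set X) : measurable Y -> measurable (xi v @^-1` Y).
Proof.
by move=> mY; rewrite -[X in measurable X]setTI; apply: (measurable_funPT (xi v)).
Qed.

Let mcodes g : measurable (codes @^-1` [set g]).
Proof.
rewrite codesE; apply: fin_bigcap_measurable => // v _.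
exact/mxi/mcode.
Qed.

Definition all_codes_differ : set T :=
  [set w | forall i, code (xi (i, true) w) != code (xi (i, false) w)].

Let all_codes_differE :
  all_codes_differ = codes @^-1` [set` ffun_on (fun q : W * W => q.1 != q.2)].
Proof.
apply/seteqP; split=> [w H |w /= /ffun_onP H i].
  by apply/ffun_onP => i; rewrite ffunE; exact: H.
by have := H i; rewrite ffunE.
Qed.

Lemma measurable_all_codes_differ : measurable all_codes_differ.
Proof.
rewrite all_codes_differE.
set Q := ffun_on _.
have -> : codes @^-1` [set` Q] = \bigcup_(g in [set` Q]) codes @^-1` [set g].
  by apply/seteqP; split=> [x Qx|x [u Qu /= ->]]//; exists (codes x).
exact: fin_bigcup_measurable.
Qed.

Lemma all_codes_differ_le : (0 < n)%N ->
    mutually_independent xi -> identically_distributed xi ->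
  (P all_codes_differ <= ((1 - #|W|%:R^-1) ^+ n)%:E)%E.
Proof.
move=> n0 indep ident; pose v0 : 'I_n * bool := (Ordinal n0, true).
pose p u : R := fine (P (xi v0 @^-1` (code @^-1` [set u]))).
have pE v u : P (xi v @^-1` (code @^-1` [set u])) = (p u)%:E.
  by rewrite (ident v v0)// fineK// fin_num_measure//; exact/mxi/mcode.
have p1 : \sum_u p u = 1.
  apply: EFin_inj; rewrite -sumEFin -[RHS](probability_setT P).
  rewrite -(preimage_setT (code \o xi v0)) (_ : setT = [set` predT]).
    rewrite measure_preimage_finType; first by apply: eq_bigr => u _; rewrite -(pE v0).
    by move=> u; rewrite comp_preimage; exact/mxi/mcode.
  by apply/seteqP.
have PE g : P (codes @^-1` [set g]) = (\prod_i (p (g i).1 * p (g i).2))%:E.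
  rewrite codesE indep => [|v]; last exact: mcode.
  rewrite (eq_bigr (fun v => (p (if v.2 then (g v.1).1 else (g v.1).2))%:E));
    last by move=> v _; exact: pE.
  rewrite prodEFin; congr EFin.
  rewrite (eq_bigl predT); last by move=> v; rewrite inE.
  rewrite -(pair_bigA _ (fun i b => p (if b then (g i).1 else (g i).2))) /=.
  by apply: eq_bigr => i _; rewrite big_bool.
rewrite all_codes_differE measure_preimage_finType//.
rewrite (eq_bigr _ (fun g _ => PE g)).
(* Distributivity turns the sum over all families of unequal pairs into a product over gadgets of
   the same off-diagonal sum. *)
rewrite sumEFin -(bigA_distr_big _ (fun _ q => p q.1 * p q.2)) lee_fin.
rewrite prodr_const card_ord lerXn2r ?sum_neq_le//.
  rewrite nnegrE; apply: sumr_ge0 => q _.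
  by rewrite mulr_ge0// fine_ge0.
by rewrite nnegrE subr_ge0 invf_le1 ?ler1n ?ltr0n ?(card_gt0_of_sum1 p1).
Qed.

End PairsOfCodes.

(** * Behaviour of a sender before its first acknowledgement *)

Section NeverAcknowledged.
Variables (d : measure_display) (X : measurableType d).
Variable A : ack_only_algorithm X.

(** No other link enters this recursion, so the independence of the tapes passes to the
    decisions. *)
Fixpoint silent_state (t : nat) (x : X) : state A :=
  if t is t'.+1 then next false (silent_state t' x, x) else init A.

(* The decision taken in slot [t.+1]. *)
Definition decision (t : nat) (x : X) : bool := transmit (silent_state t x, x).

Definition decisions (k : nat) (x : X) : {ffun 'I_k -> bool} :=
  [ffun t : 'I_k => decision t x].

Lemma measurable_silent_state t : measurable_fun setT (silent_state t).
Proof.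
elim: t => [|t IH] /=; first exact: measurable_cst.
apply: (measurableT_comp (g := fun x => (silent_state t x, x))
  (@measurable_next _ _ A false)).
by apply: measurable_fun_pair => //; exact: measurable_id.
Qed.

Lemma measurable_decision t : measurable_fun setT (decision t).
Proof.
apply: (measurableT_comp (g := fun x => (silent_state t x, x))
  (@measurable_transmit _ _ A)).
apply: measurable_fun_pair; first exact: measurable_silent_state.
exact: measurable_id.
Qed.

Lemma measurable_decisions k u : measurable (decisions k @^-1` [set u]).
Proof.
have -> : decisions k @^-1` [set u] =
    \bigcap_(t in [set: 'I_k]) (decision t @^-1` [set u t]).
  apply/seteqP; split=> [x /= <- t _ |x H]; first by rewrite /= ffunE.
  by apply/ffunP => t; rewrite ffunE; exact: H.
apply: fin_bigcap_measurable => // t _.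
by rewrite -[X in measurable X]setTI; exact: measurable_decision.
Qed.

End NeverAcknowledged.

(** * Symmetric gadgets stay active *)

Section GadgetExecution.
Variables (R : realType) (alpha : R) (n : nat).
Local Notation L := (@gadget_links R n).

Lemma received_power_gadget (i : 'I_n) (b c : bool) :
  received_power alpha L (i, b) (i, c) = 1%E.
Proof.
rewrite /received_power /dist /= opprD addrA subrr sub0r normrN normr1.
by rewrite powR1 inve1.
Qed.

(** A transmitting link has a transmitting twin, whose interference equals the signal; the other
    terms only add to it, so the SINR is at most 1 < 2. *)
Lemma collision_fails (S : {set 'I_n * bool}) (i : 'I_n) (b : bool) :
  ((i, true) \in S) = ((i, false) \in S) -> ~~ success alpha 2 0 L S (i, b).
Proof.
move=> SE; rewrite /success; have [iS|//] := boolP ((i, b) \in S); rewrite /= -ltNge.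
have inS : (i, ~~ b) \in S by move: iS SE; case: b => /= -> //; case: (_ \in S).
rewrite /sinr received_power_gadget div1e adde0.
rewrite (bigD1 (i, ~~ b)) /=; last first.
  by rewrite inS /=; apply/eqP => -[]; case: b {iS inS}.
rewrite received_power_gadget; set s := (\sum_(_ | _) _)%E.
have s0 : (0 <= s)%E by apply: sume_ge0 => v _; rewrite inve_ge0 lee_fin powR_ge0.
apply: (@le_lt_trans _ _ 1%E); last by rewrite lte_fin ltr1n.
by rewrite -[leRHS]inve1 lee_pV2 ?inE ?adde_ge0// leeDl.
Qed.

Variables (d : measure_display) (X : measurableType d).
Variables (A : ack_only_algorithm X) (tape : 'I_n * bool -> X).

Variables (k : nat) (i : 'I_n).
Hypothesis same_decisions :
  decisions A k (tape (i, true)) = decisions A k (tape (i, false)).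

Local Notation conf := (config alpha 2 0 L A tape).

Let fails_at_silent t : (t < k)%N ->
    (forall b, conf t (i, b) = silent_state A t (tape (i, b))) ->
  forall b, ~~ success alpha 2 0 L (transmitters tape (conf t)) (i, b).
Proof.
move=> tk silent b; apply: collision_fails; rewrite !inE !silent.
by have /ffunP/(_ (Ordinal tk)) := same_decisions; rewrite !ffunE.
Qed.

(** By induction: while both real states are the silent ones, the equal decisions make the slot
    fail, so the next acknowledgement is again [false]. *)
Lemma config_same_decisions t : (t <= k)%N ->
  forall b, conf t (i, b) = silent_state A t (tape (i, b)).
Proof.
elim: t => [//|t IH] tk b /=.
have {}IH := IH (ltnW tk).
by rewrite (negbTE (fails_at_silent tk IH b)) IH.
Qed.

Lemma active_same_decisions t : (t <= k.+1)%N -> active alpha A tape i t.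
Proof.
move=> tk [|s] b // /andP[_ st].
(* Being active at [t] concerns slots up to [t - 1] only, so [k] equal decisions reach time
   [k + 1]. *)
have sk : (s < k)%N by apply: leq_trans st _; case: t tk.
by apply: fails_at_silent => //; exact/config_same_decisions/ltnW.
Qed.

Lemma inactivity_time_ge : ((k.+1%:R)%:E <= inactivity_time alpha A tape)%E.
Proof.
apply: le_ereal_inf_tmp => _ [t [_ inactive] <-]; rewrite lee_fin ler_nat.
rewrite leqNgt; apply/negP => tk; apply: (inactive i).
exact/active_same_decisions/ltnW.
Qed.

End GadgetExecution.

Lemma inactivity_time_ge0 (R : realType) (alpha : R) (n : nat)
    (d : measure_display) (X : measurableType d) (A : ack_only_algorithm X)
    (tape : 'I_n * bool -> X) :
  (0 <= inactivity_time alpha A tape)%E.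
Proof. by apply: le_ereal_inf_tmp => _ [t _ <-]; rewrite lee_fin. Qed.

(** * Numerical estimates and conclusion *)

Lemma onem_invX_le_half (R : realType) (m n : nat) : (0 < m)%N -> (m <= n)%N ->
  (1 - m%:R^-1) ^+ n <= 2^-1 :> R.
Proof.
(* From 1 - 1/m <= exp(-1/m) the power is at most exp(-n/m), and 2 <= 1 + n/m <= exp(n/m). *)
move=> m0 mn; apply: (@le_trans _ _ (expR (- m%:R^-1) ^+ n)).
  rewrite lerXn2r ?nnegrE ?expR_ge0 ?expR_ge1Dx//.
  by rewrite subr_ge0 invf_le1 ?ler1n ?ltr0n.
rewrite -expRM_natl mulrN expRN lef_pV2 ?posrE ?expR_gt0//.
apply: le_trans (expR_ge1Dx _).
by rewrite -[X in X <= _]/(1 + 1) lerD2l ler_pdivlMr ?ltr0n// mul1r ler_nat.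
Qed.

(** Combines n < 2^(k+1), for k the truncated logarithm, with ln 2 <= 1. *)
Lemma ln_le_trunc_log (R : realType) (n : nat) : (0 < n)%N ->
  ln n%:R <= (trunc_log 2 n).+1%:R :> R.
Proof.
move=> n0; apply: (@le_trans _ _ (ln ((2 ^ (trunc_log 2 n).+1)%N%:R))).
  by rewrite ler_ln ?posrE ?ltr0n ?expn_gt0// ler_nat ltnW// trunc_log_ltn.
rewrite natrX lnXn// -[leLHS]mulr_natr ger_pMl ?ltr0n//.
by have := @le_ln1Dx R 1; apply; rewrite (lt_trans _ ltr01)// ltrN10.
Qed.

Theorem theorem4 (R : realType) (alpha : R) (alpha_gt1 : 1 < alpha) :
  exists2 c : R, 0 < c & exists n0 : nat, forall n : nat, (n0 <= n)%N ->
    forall (d : measure_display) (X : measurableType d)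
      (A : ack_only_algorithm X)
      (d' : measure_display) (T : measurableType d') (P : probability T R)
      (xi : 'I_n * bool -> {RV P >-> X}),
    mutually_independent xi -> identically_distributed xi ->
    ((c * ln n%:R)%:E <=
      \int[P]_w inactivity_time alpha A (fun v => xi v w))%E.
Proof.
exists 2^-1; first by rewrite invr_gt0.
exists 1 => n n0 d X A d' T P xi indep ident.
(* The largest [k] for which the 2^k decision words do not outnumber the gadgets. *)
pose k := trunc_log 2 n.
pose G := all_codes_differ xi (decisions A k).
have mG : measurable G.
  by apply: measurable_all_codes_differ; exact: measurable_decisions.
have PG : (P G <= (2^-1)%:E)%E.
  apply: le_trans (all_codes_differ_le _ n0 indep ident) _;
    first exact: measurable_decisions.
  rewrite lee_fin card_ffun card_bool card_ord onem_invX_le_half ?expn_gt0//.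
  exact: trunc_logP.
have PGc : ((2^-1)%:E <= P (~` G))%E.
  rewrite probability_setC// leeBrDr ?fin_num_measure//.
  by apply: (le_trans (leeD2l _ PG)); rewrite -EFinD lee_fin; lra.
(* Outside [G] some gadget has two equal words, which forces the inactivity time to be at least
   [k + 1]. *)
apply: (@le_trans _ _ ((k.+1%:R)%:E * P (~` G))%E); last first.
  apply: ge0_integral_ge_mass => //; first exact: measurableC.
    by move=> w; exact: inactivity_time_ge0.
  by move=> w /existsNP[i /negP/negPn/eqP same]; exact: inactivity_time_ge same.
apply: (@le_trans _ _ ((k.+1%:R)%:E * (2^-1)%:E)%E); last by rewrite lee_pmul2l.
by rewrite -EFinM lee_fin mulrC ler_pM2r ?invr_gt0// ln_le_trunc_log.
Qed.
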